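(* Let $\Pi$ and $\Pi'$ be $n$-dimensional linear spaces, both satisfying the exchange axiom and the axiom (P2), let $k\ge 1$ with $n\ge 2k+1$, and let $f$ be an injection of $\mathcal{G}_k(\Pi)$ to $\mathcal{G}_k(\Pi')$ sending base subsets to base subsets. For each $(k-1)$-dimensional subspace $S$ of $\Pi$ let $f_{k-1}(S)$ be the unique subspace $S'$ of $\Pi'$ of dimension $k-1$ or $k+1$ with $f(\mathcal{G}_k(S))\subset\mathcal{G}_k(S')$. Suppose there is a strong embedding $g$ of $\Pi$ to $\Pi'$ with $f_{k-1}(S)=\overline{g(S)}$ for all $S\in\mathcal{G}_{k-1}(\Pi)$. Then $f(U)=\overline{g(U)}$ for all $U\in\mathcal{G}_k(\Pi)$.
   Context: A linear space $\Pi=(P,\mathcal{L})$ is a set $P$ of points with a family $\mathcal{L}$ of proper subsets (lines) such that each line has at least two points and any two distinct points $p,q$ lie on exactly one line $pq$. Points are collinear if some line contains them. A subspace is a set $S\subset P$ with $pq\subset S$ for all distinct $p,q\in S$; $\overline{X}$ is the smallest subspace containing $X$. A set $X$ is independent if $\overline{X}$ is not spanned by a proper subset of $X$; a base of $\Pi$ is an independent set spanning $P$. A subspace is $m$-dimensional if $m+1$ is the smallest number of points spanning it. Exchange axiom: for every $X\subset P$ and $p_1,p_2\in P\setminus\overline{X}$, $p_2\in\overline{X\cup\{p_1\}}$ implies $p_1\in\overline{X\cup\{p_2\}}$. Axiom (P2): every line has at least three points. $\mathcal{G}_k(\Pi)$ is the set of $k$-dimensional subspaces; for a subspace $U$, $\mathcal{G}_k(U)$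 is the set of $k$-dimensional subspaces incident to $U$ (contained in $U$ or containing $U$). The base subset of $\mathcal{G}_k(\Pi)$ associated with a base $B$ is the set of all $k$-dimensional subspaces spanned by points of $B$. A strong embedding of $\Pi$ to $\Pi'$ is an injection $g:P\to P'$ sending collinear triples to collinear triples, non-collinear triples to non-collinear triples and independent sets to independent sets; then $\dim\overline{g(S)}=\dim S$ for every subspace $S$. *)

(* Defs.v *)
(* sets are predicates [T -> Prop]; equality of sets is
   Leibniz equality, which is extensional under funext/propext (whitelisted). *)
From Stdlib Require Import List.
Import ListNotations.
Set Implicit Arguments.

Definition subset {T : Type} (A B : T -> Prop) : Prop := forall x, A x -> B x.

Record linear_space (P : Type) (L : (P -> Prop) -> Prop) : Prop := {
  ls_proper : forall l, L l -> exists p, ~ l p;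
  ls_two : forall l, L l -> exists p q, p <> q /\ l p /\ l q;
  ls_line : forall p q, p <> q ->
    exists l, L l /\ l p /\ l q /\ (forall l', L l' -> l' p -> l' q -> l' = l)
}.

Definition collinear (P : Type) (L : (P -> Prop) -> Prop) (p q r : P) : Prop :=
  exists l, L l /\ l p /\ l q /\ l r.

Definition subspace (P : Type) (L : (P -> Prop) -> Prop) (S : P -> Prop) : Prop :=
  forall p q l, p <> q -> S p -> S q -> L l -> l p -> l q -> subset l S.

Definition span (P : Type) (L : (P -> Prop) -> Prop) (X : P -> Prop) : P -> Prop :=
  fun x => forall S, subspace L S -> subset X S -> S x.

Definition independent (P : Type) (L : (P -> Prop) -> Prop) (X : P -> Prop) : Prop :=
  forall Y, subset Y X -> (exists x, X x /\ ~ Y x) ->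
    ~ (forall x, span L Y x <-> span L X x).

Definition has_dim (P : Type) (L : (P -> Prop) -> Prop) (S : P -> Prop) (m : nat) : Prop :=
  subspace L S /\
  (exists xs : list P, length xs = m + 1 /\
     forall x, span L (fun p => In p xs) x <-> S x) /\
  (forall ys : list P, (forall x, span L (fun p => In p ys) x <-> S x) ->
     m + 1 <= length ys).

Definition Gk (P : Type) (L : (P -> Prop) -> Prop) (k : nat) (U : P -> Prop) : Prop :=
  has_dim L U k.

Definition Gk_inc (P : Type) (L : (P -> Prop) -> Prop) (k : nat) (S U : P -> Prop) : Prop :=
  has_dim L U k /\ (subset U S \/ subset S U).

Definition is_base (P : Type) (L : (P -> Prop) -> Prop) (B : P -> Prop) : Prop :=
  independent L B /\ (forall x, span L B x).

Definition base_subset (P : Type) (L : (P -> Prop) -> Prop) (k : nat)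
    (F : (P -> Prop) -> Prop) : Prop :=
  exists B, is_base L B /\
    forall U, F U <-> (has_dim L U k /\
                       exists X, subset X B /\ (forall x, U x <-> span L X x)).

Definition image_fam (P P' : Type) (f : (P -> Prop) -> (P' -> Prop))
    (F : (P -> Prop) -> Prop) : (P' -> Prop) -> Prop :=
  fun U' => exists U, F U /\ f U = U'.

Definition image_pts (P P' : Type) (g : P -> P') (X : P -> Prop) : P' -> Prop :=
  fun y => exists x, X x /\ g x = y.

Definition exchange_axiom (P : Type) (L : (P -> Prop) -> Prop) : Prop :=
  forall (X : P -> Prop) (p1 p2 : P),
    ~ span L X p1 -> ~ span L X p2 ->
    span L (fun x => X x \/ x = p1) p2 -> span L (fun x => X x \/ x = p2) p1.

Definition axiom_P2 (P : Type) (L : (P -> Prop) -> Prop) : Prop :=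
  forall l, L l -> exists a b c, l a /\ l b /\ l c /\ a <> b /\ a <> c /\ b <> c.

Definition strong_embedding (P P' : Type) (L : (P -> Prop) -> Prop)
    (L' : (P' -> Prop) -> Prop) (g : P -> P') : Prop :=
  (forall x y, g x = g y -> x = y) /\
  (forall p q r, collinear L p q r -> collinear L' (g p) (g q) (g r)) /\
  (forall p q r, ~ collinear L p q r -> ~ collinear L' (g p) (g q) (g r)) /\
  (forall X, independent L X -> independent L' (image_pts g X)).

Definition fkm1_candidate (P P' : Type) (L : (P -> Prop) -> Prop)
    (L' : (P' -> Prop) -> Prop) (k : nat) (f : (P -> Prop) -> (P' -> Prop))
    (S : P -> Prop) (S' : P' -> Prop) : Prop :=
  (has_dim L' S' (k - 1) \/ has_dim L' S' (k + 1)) /\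
  (forall U, Gk_inc L k S U -> Gk_inc L' k S' (f U)).

(* Main.v *)
Require Import Defs.
From Stdlib Require Import List Permutation Lia Classical FunctionalExtensionality PropExtensionality FinFun.
Import ListNotations.
Set Implicit Arguments.

(* Write U as the span of a shortest list a, b, c_1, ..., c_(k-1).  The
   (k-1)-subspaces S1 = <b, c_i> and S2 = <a, c_i> lie in U, so f(U) is incident
   with each <g(S_i)>, and both <g(S_i)> lie in W = <g(U)>.  A strong embedding
   preserves dimension (via the Steinitz exchange lemma, which follows from the
   exchange axiom), so W and f(U) are both k-dimensional.  If f(U) lies in some
   <g(S_i)> then f(U) is contained in W; otherwise f(U) contains g(a), g(b) and
   all g(c_i), hence W.  Nested subspaces of equal finite dimension coincide. *)

Lemma subset_antisym {T : Type} (A B : T -> Prop) : subset A B -> subset B A -> A = B.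
Proof.
  intros AB BA. apply functional_extensionality. intro x.
  apply propositional_extensionality. split; auto.
Qed.

Section Span.

Variables (P : Type) (L : (P -> Prop) -> Prop).

Lemma span_inc X : subset X (span L X).
Proof. intros x Xx S _ XS. exact (XS x Xx). Qed.

Lemma span_subspace X : subspace L (span L X).
Proof.
  intros p q l pq Xp Xq Ll lp lq x lx S SS XS.
  exact (SS p q l pq (Xp S SS XS) (Xq S SS XS) Ll lp lq x lx).
Qed.

Lemma span_least X S : subspace L S -> subset X S -> subset (span L X) S.
Proof. intros SS XS x Xx. exact (Xx S SS XS). Qed.

Lemma span_sub_span X Y : subset X (span L Y) -> subset (span L X) (span L Y).
Proof. apply span_least, span_subspace. Qed.

Lemma span_mono X Y : subset X Y -> subset (span L X) (span L Y).
Proof. intros XY. apply span_sub_span. intros x Xx. apply span_inc, XY, Xx. Qed.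

Definition spans (xs : list P) (A : P -> Prop) : Prop :=
  forall x, span L (fun p => In p xs) x <-> A x.

(* Independence relative to [X] is what makes the induction in [steinitz] go through;
   a list with a repeated point is never independent. *)
Definition indep_over (X : P -> Prop) (I : list P) : Prop :=
  forall x l, Permutation I (x :: l) -> ~ span L (fun p => X p \/ In p l) x.

Lemma indep_over_NoDup X I : indep_over X I -> NoDup I.
Proof.
  induction I as [|x l IH]; intros HI; constructor.
  - intro lx. apply (HI x l (Permutation_refl _)), span_inc. now right.
  - apply IH. intros z m lzm Hz.
    apply (HI z (x :: m)).
    + eapply perm_trans; [apply perm_skip, lzm | apply perm_swap].
    + revert Hz. apply span_mono. intro q. simpl. tauto.
Qed.

Lemma spans_min_indep A xs :
  spans xs A -> (forall ys, spans ys A -> length xs <= length ys) ->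
  indep_over (fun _ => False) xs.
Proof.
  intros xs_A xs_min x l xl Hx.
  assert (l_A : spans l A).
  { intro q. split; intro Hq.
    - apply (proj1 (xs_A q)). revert Hq. apply span_mono. intros r lr.
      exact (Permutation_in _ (Permutation_sym xl) (in_cons _ _ _ lr)).
    - apply (proj2 (xs_A q)) in Hq. revert Hq. apply span_sub_span. intros r xs_r.
      destruct (Permutation_in _ xl xs_r) as [<- | lr].
      + revert Hx. apply span_mono. intros s [[] | ls]. exact ls.
      + apply span_inc, lr. }
  specialize (xs_min l l_A). apply Permutation_length in xl. simpl in xl. lia.
Qed.

Lemma indep_over_independent xs :
  indep_over (fun _ => False) xs -> independent L (fun p => In p xs).
Proof.
  intros xs_ind Y Y_xs [x [xs_x Nx]] Y_span.
  apply in_split in xs_x as [l1 [l2 ->]].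
  assert (x_perm : Permutation (l1 ++ x :: l2) (x :: l1 ++ l2))
    by apply Permutation_sym, Permutation_middle.
  apply (xs_ind x _ x_perm).
  assert (Yx : span L Y x) by (apply (proj2 (Y_span x)), span_inc, in_elt).
  revert Yx. apply span_mono. intros q Yq. right.
  destruct (Permutation_in _ x_perm (Y_xs q Yq)) as [<- | ?]; [contradiction | assumption].
Qed.

Lemma independent_indep_over xs :
  NoDup xs -> independent L (fun p => In p xs) -> indep_over (fun _ => False) xs.
Proof.
  intros xs_nodup xs_ind y l yl Hy.
  assert (l_xs : forall q, In q l -> In q xs)
    by (intros q lq; exact (Permutation_in _ (Permutation_sym yl) (in_cons _ _ _ lq))).
  apply (xs_ind (fun p => In p l) l_xs).
  - exists y. split; [exact (Permutation_in _ (Permutation_sym yl) (in_eq _ _)) |].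
    exact (proj1 (proj1 (NoDup_cons_iff y l) (Permutation_NoDup yl xs_nodup))).
  - intro x. split; apply span_sub_span; intros q Hq.
    + apply span_inc, l_xs, Hq.
    + destruct (Permutation_in _ yl Hq) as [<- | lq].
      * revert Hy. apply span_mono. intros r [[] | lr]. exact lr.
      * apply span_inc, lq.
Qed.

Hypothesis EX : exchange_axiom L.

Lemma indep_over_exchange X y I x l :
  indep_over X I -> Permutation I (x :: l) ->
  span L (fun q => (X q \/ q = y) \/ In q l) x ->
  indep_over (fun q => X q \/ q = y) l.
Proof.
  intros HI Ixl Hx z m lzm Hz.
  set (Z := fun q => X q \/ In q m).
  assert (Nz : ~ span L Z z).
  { intro H. apply (HI z (x :: m)).
    - eapply perm_trans; [exact Ixl|]. eapply perm_trans; [apply perm_skip, lzm|apply perm_swap].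
    - revert H. apply span_mono. intro q. unfold Z; simpl. tauto. }
  assert (Ny : ~ span L Z y).
  { intro H. apply Nz. revert Hz. apply span_sub_span.
    intros q [[Xq | ->] | mq]; [apply span_inc; now left | exact H | apply span_inc; now right]. }
  assert (Hy : span L (fun q => Z q \/ q = z) y).
  { apply EX; [exact Ny | exact Nz |]. revert Hz. apply span_mono. intro q. unfold Z. tauto. }
  apply (HI x (z :: m)); [eapply perm_trans; [exact Ixl | apply perm_skip, lzm]|].
  revert Hx. apply span_sub_span. intros q [[Xq | ->] | lq].
  - apply span_inc. now left.
  - revert Hy. apply span_mono. intros r [[Xr | mr] | ->]; simpl; auto.
  - apply span_inc. right. exact (Permutation_in _ lzm lq).
Qed.

Lemma steinitz J : forall X I, indep_over X I ->
  (forall p, In p I -> span L (fun q => X q \/ In q J) p) -> length I <= length J.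
Proof.
  induction J as [|y J IH]; intros X I HI IJ.
  - destruct I as [|x l]; simpl; [lia|]. exfalso.
    apply (HI x l (Permutation_refl _)).
    apply (span_mono (X := fun q => X q \/ In q [])); [intro q; simpl; tauto|].
    apply IJ. now left.
  - assert (IJy : forall p, In p I -> span L (fun q => (X q \/ q = y) \/ In q J) p).
    { intros p Ip. generalize (IJ p Ip). apply span_mono. intros q [Xq | [<- | Jq]]; auto. }
    destruct (classic (indep_over (fun q => X q \/ q = y) I)) as [Hy|Hy].
    + specialize (IH _ _ Hy IJy). simpl. lia.
    + apply not_all_ex_not in Hy as [x Hy]. apply not_all_ex_not in Hy as [l Hy].
      apply imply_to_and in Hy as [Ixl Hx]. apply NNPP in Hx.
      assert (IH' := IH _ _ (indep_over_exchange HI Ixl Hx)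
                       (fun p lp => IJy p (Permutation_in _ (Permutation_sym Ixl) (or_intror lp)))).
      apply Permutation_length in Ixl. simpl in *. lia.
Qed.

Lemma indep_over_cons X xs b :
  indep_over X xs -> ~ span L (fun p => X p \/ In p xs) b -> indep_over X (b :: xs).
Proof.
  intros xs_ind Nb x l bxl Hx.
  destruct (classic (x = b)) as [-> | xb].
  - apply Nb. revert Hx. apply span_mono. intros q [Xq | lq]; [now left | right].
    exact (Permutation_in _ (Permutation_sym (Permutation_cons_inv bxl)) lq).
  - assert (xs_x : In x xs).
    { destruct (Permutation_in _ (Permutation_sym bxl) (in_eq x l)) as [-> | ?];
        [congruence | assumption]. }
    apply in_split in xs_x as [l1 [l2 ->]].
    set (l' := l1 ++ l2).
    assert (x_perm : Permutation (l1 ++ x :: l2) (x :: l'))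
      by apply Permutation_sym, Permutation_middle.
    assert (l_perm : Permutation l (b :: l')).
    { apply Permutation_cons_inv with x. eapply perm_trans; [apply Permutation_sym, bxl |].
      eapply perm_trans; [apply perm_skip, x_perm | apply perm_swap]. }
    set (Z := fun p => X p \/ In p l').
    assert (Nb' : ~ span L Z b).
    { intro H. apply Nb. revert H. apply span_mono. intros q [Xq | lq]; [now left | right].
      apply (Permutation_in _ (Permutation_sym x_perm)). now right. }
    assert (Hb : span L (fun p => Z p \/ p = x) b).
    { apply EX; [exact Nb' | exact (xs_ind x l' x_perm) |]. revert Hx. apply span_mono.
      intros q [Xq | lq]; [left; now left |].
      destruct (Permutation_in _ l_perm lq) as [<- | ?]; [now right | left; now right]. }
    apply Nb. revert Hb. apply span_mono. intros q [[Xq | lq] | ->]; [now left | right ..].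
    + apply (Permutation_in _ (Permutation_sym x_perm)). now right.
    + apply (Permutation_in _ (Permutation_sym x_perm)). now left.
Qed.

Lemma has_dim_sub_eq A B m : has_dim L A m -> has_dim L B m -> subset A B -> A = B.
Proof.
  intros [_ [[xs [xs_len xs_A]] A_min]] [_ [[ys [ys_len ys_B]] _]] AB.
  apply subset_antisym; [exact AB |]. intros b Bb. apply NNPP. intro Nb.
  assert (xs_ind : indep_over (fun _ => False) xs).
  { apply (spans_min_indep xs_A). intros zs zs_A. rewrite xs_len. exact (A_min zs zs_A). }
  assert (bxs_ind : indep_over (fun _ => False) (b :: xs)).
  { apply indep_over_cons; [exact xs_ind |]. intro H. apply Nb, (proj1 (xs_A b)).
    revert H. apply span_mono. intros q [[] | xs_q]. exact xs_q. }
  assert (Hle : length (b :: xs) <= length ys).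
  { apply (steinitz ys bxs_ind). intros p bxs_p.
    apply (span_mono (X := fun q => In q ys)); [intros q ?; now right |].
    apply (proj2 (ys_B p)). destruct bxs_p as [<- | xs_p]; [exact Bb |].
    apply AB, (proj1 (xs_A p)), span_inc, xs_p. }
  simpl in Hle. lia.
Qed.

Lemma has_dim_drop A xs a l m :
  has_dim L A m -> spans xs A -> length xs = m + 1 -> Permutation xs (a :: l) -> 1 <= m ->
  has_dim L (span L (fun p => In p l)) (m - 1).
Proof.
  intros [_ [_ A_min]] xs_A xs_len xal m_pos.
  assert (l_len : length l = m) by (apply Permutation_length in xal; simpl in xal; lia).
  split; [apply span_subspace | split].
  - exists l. split; [lia | intro x; tauto].
  - intros ys ys_l.
    enough (m + 1 <= length (a :: ys)) by (simpl in *; lia).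
    apply A_min. intro x. split; intro Hx.
    + apply (proj1 (xs_A x)). revert Hx. apply span_sub_span. intros q [<- | ys_q].
      * apply span_inc, (Permutation_in _ (Permutation_sym xal)), in_eq.
      * generalize (proj1 (ys_l q) (span_inc q ys_q)). apply span_mono. intros r lr.
        exact (Permutation_in _ (Permutation_sym xal) (in_cons _ _ _ lr)).
    + apply (proj2 (xs_A x)) in Hx. revert Hx. apply span_sub_span. intros q xs_q.
      destruct (Permutation_in _ xal xs_q) as [<- | lq]; [apply span_inc, in_eq |].
      generalize (proj2 (ys_l q) (span_inc q lq)). apply span_mono. intros r ys_r. now right.
Qed.

Lemma has_dim_eq_of_incident F W W1 W2 m :
  has_dim L F m -> has_dim L W m -> subset W1 W -> subset W2 W ->
  subset W (span L (fun p => W1 p \/ W2 p)) ->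
  (subset F W1 \/ subset W1 F) -> (subset F W2 \/ subset W2 F) -> F = W.
Proof.
  intros F_dim W_dim W1_W W2_W W_span [F_W1 | W1_F] [F_W2 | W2_F].
  1, 2: apply (has_dim_sub_eq F_dim W_dim); intros x Fx; exact (W1_W x (F_W1 x Fx)).
  - apply (has_dim_sub_eq F_dim W_dim); intros x Fx; exact (W2_W x (F_W2 x Fx)).
  - symmetry. apply (has_dim_sub_eq W_dim F_dim). intros x Wx.
    apply (span_least (proj1 F_dim) (X := fun p => W1 p \/ W2 p)); [| exact (W_span x Wx)].
    intros p [W1p | W2p]; auto.
Qed.

End Span.

Section Embedding.

Variables (P P' : Type) (L : (P -> Prop) -> Prop) (L' : (P' -> Prop) -> Prop) (g : P -> P').

Lemma span_image :
  (forall x y, g x = g y -> x = y) ->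
  (forall p q r, collinear L p q r -> collinear L' (g p) (g q) (g r)) ->
  forall X x, span L X x -> span L' (image_pts g X) (g x).
Proof.
  intros g_inj g_col X.
  apply (span_least (S := fun x => span L' (image_pts g X) (g x))).
  - intros p q l pq Sp Sq Ll lp lq r lr.
    destruct (g_col p q r) as [l' [L'l' [l'p [l'q l'r]]]]; [now exists l |].
    assert (gpq : g p <> g q) by (intro E; exact (pq (g_inj p q E))).
    exact (span_subspace l' gpq Sp Sq L'l' l'p l'q _ l'r).
  - intros x Xx. apply span_inc. now exists x.
Qed.

Lemma has_dim_span_image U m :
  strong_embedding L L' g -> exchange_axiom L' ->
  has_dim L U m -> has_dim L' (span L' (image_pts g U)) m.
Proof.
  intros [g_inj [g_col [_ g_ind]]] EX' [_ [[xs [xs_len xs_U]] U_min]].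
  assert (xs_ind : indep_over L (fun _ => False) xs).
  { apply (spans_min_indep xs_U). intros zs zs_U. rewrite xs_len. exact (U_min zs zs_U). }
  assert (image_xs : image_pts g (fun p => In p xs) = (fun y => In y (map g xs))).
  { apply subset_antisym.
    - intros y [x [xs_x <-]]. now apply in_map.
    - intros y map_y. apply in_map_iff in map_y as [x [<- xs_x]]. now exists x. }
  assert (map_U : forall y, In y (map g xs) -> image_pts g U y).
  { intros y map_y. apply in_map_iff in map_y as [x [<- xs_x]].
    exists x. split; [apply (proj1 (xs_U x)), span_inc, xs_x | reflexivity]. }
  assert (map_ind : indep_over L' (fun _ => False) (map g xs)).
  { apply independent_indep_over.
    - exact (Injective_map_NoDup g_inj (indep_over_NoDup xs_ind)).
    - rewrite <- image_xs. exact (g_ind _ (indep_over_independent xs_ind)). }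
  split; [apply span_subspace | split].
  - exists (map g xs). split; [now rewrite length_map |].
    intro y. split; apply span_sub_span.
    + intros y' map_y'. apply span_inc, map_U, map_y'.
    + intros y' [x [Ux <-]]. rewrite <- image_xs.
      apply (span_image g_inj g_col), (proj2 (xs_U x)), Ux.
  - intros zs zs_span. rewrite <- xs_len, <- (length_map g).
    apply (steinitz EX' zs map_ind). intros y map_y.
    apply (span_mono (X := fun q => In q zs)); [intros q ?; now right |].
    apply (proj2 (zs_span y)), span_inc, map_U, map_y.
Qed.

End Embedding.

Theorem lemma2p9 (P P' : Type) (L : (P -> Prop) -> Prop) (L' : (P' -> Prop) -> Prop)
  (n k : nat) (f : (P -> Prop) -> (P' -> Prop)) (g : P -> P') :
  linear_space L -> linear_space L' ->
  has_dim L (fun _ => True) n -> has_dim L' (fun _ => True) n ->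
  exchange_axiom L -> exchange_axiom L' ->
  axiom_P2 L -> axiom_P2 L' ->
  1 <= k -> 2 * k + 1 <= n ->
  (forall U, Gk L k U -> Gk L' k (f U)) ->
  (forall U V, Gk L k U -> Gk L k V -> f U = f V -> U = V) ->
  (forall F, base_subset L k F -> base_subset L' k (image_fam f F)) ->
  strong_embedding L L' g ->
  (forall S, Gk L (k - 1) S ->
     fkm1_candidate L L' k f S (span L' (image_pts g S)) /\
     (forall S', fkm1_candidate L L' k f S S' -> S' = span L' (image_pts g S))) ->
  forall U, Gk L k U -> f U = span L' (image_pts g U).
Proof.
  intros _ _ _ _ _ EX' _ _ k_pos _ f_dim _ _ g_emb f_km1 U U_dim.
  pose proof U_dim as [_ [[xs [xs_len xs_U]] _]].
  destruct xs as [| a [| b c]]; simpl in xs_len; try lia.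
  set (S1 := span L (fun p => In p (b :: c))).
  set (S2 := span L (fun p => In p (a :: c))).
  assert (S1_dim : Gk L (k - 1) S1)
    by exact (has_dim_drop U_dim xs_U xs_len (Permutation_refl _) k_pos).
  assert (S2_dim : Gk L (k - 1) S2)
    by exact (has_dim_drop U_dim xs_U xs_len (perm_swap _ _ _) k_pos).
  assert (S1_U : subset S1 U).
  { intros x Hx. apply (proj1 (xs_U x)). revert Hx. apply span_mono. intro q. simpl. tauto. }
  assert (S2_U : subset S2 U).
  { intros x Hx. apply (proj1 (xs_U x)). revert Hx. apply span_mono. intro q. simpl. tauto. }
  assert (image_U : forall S, subset S U ->
            subset (span L' (image_pts g S)) (span L' (image_pts g U))).
  { intros S S_sub. apply span_mono. intros y [x [Sx <-]]. exists x. auto. }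
  assert (incident : forall S, subset S U -> Gk L (k - 1) S ->
            subset (f U) (span L' (image_pts g S)) \/ subset (span L' (image_pts g S)) (f U)).
  { intros S S_sub S_dim. apply (proj2 (proj1 (f_km1 S S_dim)) U).
    split; [exact U_dim | now right]. }
  refine (has_dim_eq_of_incident EX' (f_dim U U_dim) (has_dim_span_image g_emb EX' U_dim)
            (image_U S1 S1_U) (image_U S2 S2_U) _
            (incident S1 S1_U S1_dim) (incident S2 S2_U S2_dim)).
  apply span_sub_span. intros y [x [Ux <-]].
  destruct g_emb as [g_inj [g_col _]].
  generalize (span_image g_inj g_col (proj2 (xs_U x) Ux)). apply span_mono.
  intros y [x' [xs_x' <-]]. destruct xs_x' as [-> | bc_x']; [right | left];
    apply span_inc; exists x'; (split; [apply span_inc; simpl; auto | reflexivity]).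
Qed.
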